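(* Let $R>0$, let $\tilde a$ be a positive harmonic function on $B_R$, and define $a:=\tilde a^{-1}$. Let $b$ and $c$ be real-valued solutions on $B_R$ to $$\Delta b=\frac{2}{a}\nabla a\cdot\nabla b,\qquad \Delta c=\frac{1}{2a}\left(|\nabla b|^2+1\right).$$ Then the function $$u(t,x)=a(x)t^2+b(x)t+c(x)$$ is a smooth solution to $$u_{tt}\Delta u-|\nabla u_t|^2=1\quad\text{on }\mathbb{R}\times B_R.$$
   Context: Here $(t,x)\in\mathbb{R}\times\mathbb{R}^m$, $B_R$ is the ball of radius $R$ centered at $0$ in $\mathbb{R}^m$, and the Laplacian $\Delta$ and gradient $\nabla$ are with respect to the variable $x$ only. *)

(* Defs.v *)
From mathcomp Require Import all_boot all_order all_algebra.
From mathcomp Require Import all_classical all_reals all_analysis.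

Set Implicit Arguments.
Unset Strict Implicit.
Unset Printing Implicit Defensive.

Import Order.TTheory GRing.Theory Num.Theory.
Import numFieldNormedType.Exports.

Local Open Scope classical_set_scope.
Local Open Scope ring_scope.

Definition dot (R : realType) (m : nat) (x y : 'rV[R]_m) : R :=
  \sum_(i < m) x 0 i * y 0 i.

(* The library norm on row vectors is the sup norm, hence the explicit
   Euclidean norm. *)
Definition enorm (R : realType) (m : nat) (x : 'rV[R]_m) : R :=
  Num.sqrt (dot x x).

Definition eball (R : realType) (m : nat) (r : R) : set 'rV[R]_m :=
  [set x | enorm x < r].

Arguments eball {R} m r.

Definition partial (R : realType) (m : nat) (i : 'I_m) (f : 'rV[R]_m -> R) :
    'rV[R]_m -> R :=
  fun x => 'D_(delta_mx 0 i) f x.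

Definition grad (R : realType) (m : nat) (f : 'rV[R]_m -> R) (x : 'rV[R]_m) :
    'rV[R]_m :=
  \row_(i < m) partial i f x.

Definition laplacian (R : realType) (m : nat) (f : 'rV[R]_m -> R)
    (x : 'rV[R]_m) : R :=
  \sum_(i < m) partial i (partial i f) x.

(* [Ck_on k U f]: f is of class C^k on the open subset U of the normed space V;
   the values of f outside U are irrelevant. In the finite-dimensional spaces V
   used here, [x |-> 'd f x] is of class C^k if and only if each
   [x |-> 'd f x v] is, and the latter is ['D_v f]. *)
Fixpoint Ck_on (R : realType) (V : normedModType R) (k : nat) (U : set V)
    (f : V -> R) : Prop :=
  match k with
  | 0 => forall x, U x -> {for x, continuous f}
  | k'.+1 => (forall x, U x -> differentiable f x) /\
             (forall v : V, Ck_on k' U (fun x => 'D_v f x))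
  end.

Definition smooth_on (R : realType) (V : normedModType R) (U : set V)
    (f : V -> R) : Prop :=
  forall k, Ck_on k U f.

Definition harmonic_on (R : realType) (m : nat) (U : set 'rV[R]_m)
    (f : 'rV[R]_m -> R) : Prop :=
  Ck_on 2 U f /\ forall x, U x -> laplacian f x = 0.

(* Main.v *)
Require Import Defs.
From HB Require Import structures.
From mathcomp Require Import all_boot all_order all_algebra.
From mathcomp Require Import all_classical all_reals all_analysis.
From mathcomp Require Import ring lra.
Import Order.TTheory GRing.Theory Num.Theory.
Import numFieldNormedType.Exports.
Local Open Scope classical_set_scope.
Local Open Scope ring_scope.
Set Implicit Arguments.
Unset Strict Implicit.
Unset Printing Implicit Defensive.

(** Write [a'] for the harmonic function, so that [a = 1 / a'].  The equation
for [u] is a pointwise computation: [grad a' = - a^-2 grad a], and expanding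
[0 = laplacian (a * a')] gives [laplacian a = 2/a |grad a|^2].  Hence the three
functions [a], [b], [c] satisfy equations whose right-hand sides are exactly
the coefficients of [t^2], [t], [1] needed for the identity.

The substance is smoothness, since [a'], [b], [c] are only assumed to be of
class C^2.  It reduces to one statement, [poisson_regularity]: a C^2 function
with smooth Laplacian is smooth.  It applies to [a'] with Laplacian 0.  The
equation for [b] says precisely that [a' * b] is harmonic, so [a' * b] and then
[b] are smooth.  Finally the Laplacian of [c] is a smooth expression in [a']
and [grad b].

[poisson_regularity] is proved without integration, from the maximum principle
alone.
- Interior estimate ([odd_difference_norm_le], [lipschitz_half_ball]).  If
  [|w| <= eta] and [|laplacian w| < eta] on a ball, then [w] is Lipschitz on the
  half ball, with constant proportional to [eta].  To bound [w(z+se) - w(z-se)],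
  one compares the odd part of [w] about [z] with an explicit quadratic barrier
  on a half cube.  The balls of the sup norm are cubes, which is the shape that
  the barrier requires.
- Consequently, if [f] is a uniform limit of C^1 functions [w] whose
  Laplacians converge uniformly to [g] ([approx_solution]), then each [f - w]
  has a small Lipschitz constant, which forces [f] to be C^1
  ([Ck1_lipschitz_approx], [approx_solution_Ck1]).
- The class of such pairs [(f, g)] is stable under differentiation, when [g] is
  C^1: difference quotients of the [w] approximate the derivative of [f]
  ([approx_solution_derive]).  Iterating gives all derivatives
  ([approx_solution_Ck]).

In this argument the approximants are never differentiated twice.  The
Laplacian is therefore used in the form of a limit of symmetric second
differences ([has_laplacian]), which passes to difference quotients and which
is nonpositive at a maximum. *)

(** * Calculus of functions of class C^k *)

Section Ck_calculus.
Context {R : realType} {V : normedModType R}.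
Implicit Types (U : set V) (f g : V -> R) (k : nat).

Lemma Ck_onW k U f : Ck_on k.+1 U f -> Ck_on k U f.
Proof.
elim: k f => [|k IH] f [df Df].
  by move=> x Ux; apply: differentiable_continuous; apply: df.
by split=> // v; apply: IH; apply: Df.
Qed.

(** Every clause in the definition of C^k is tested at one point of [U] at a
time.  Regularity at a point can therefore be established on a neighbourhood
that shrinks as [k] grows. *)
Lemma Ck_on_pointwise k U f :
  Ck_on k U f <-> forall x, U x -> Ck_on k [set x] f.
Proof.
elim: k f => [|k IH] f; first by split=> [h x Ux _ ->|h x Ux]; [exact: h|exact: (h x Ux x)].
split=> [[df Df] x Ux|h].
  split=> [y -> |v]; first exact: df.
  by have /IH := Df v; apply.
split=> [x Ux|v]; first by have [+ _] := h x Ux; apply.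
by apply/IH => x Ux; have [_] := h x Ux; apply.
Qed.

Lemma Ck_onS k U W f : U `<=` W -> Ck_on k W f -> Ck_on k U f.
Proof.
by move=> UW /Ck_on_pointwise h; apply/Ck_on_pointwise => x /UW; apply: h.
Qed.

(** Openness matters: [f] and [g] have the same germ at each point of [U], and
derivatives depend on the germ only. *)
Lemma Ck_on_eq k U f g :
  open U -> (forall x, U x -> f x = g x) -> Ck_on k U f -> Ck_on k U g.
Proof.
move=> oU; elim: k f g => [|k IH] f g fg.
  move=> cf x Ux; rewrite /prop_for /continuous_at -fg //.
  apply: cvg_trans (cf x Ux); apply: near_eq_cvg.
  by apply: filterS (open_nbhs_nbhs (conj oU Ux)) => y Uy; rewrite fg.
have nfg x : U x -> \forall y \near x, f y = g y.
  by move=> Ux; apply: filterS (open_nbhs_nbhs (conj oU Ux)) => y; apply: fg.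
case=> df Df; split=> [x Ux|v]; last first.
  by apply: IH (Df v) => x Ux; apply: near_eq_derive; apply: nfg.
have /diff_locallyP [cd /eqaddoP H] := df x Ux.
have key : g \o shift x = cst (g x) + 'd f x +o_ 0 id.
  apply/eqaddoP => e e0; have := H e e0; apply: filter_app.
  have : \forall y \near 0, U (y + x).
    have : \forall y \near x, U y by exact: open_nbhs_nbhs (conj oU Ux).
    by rewrite (near_shift 0) subr0.
  by apply: filterS => y Uy; rewrite !fctE /= -!fg.
apply/diff_locallyP; have E := diff_unique cd key.
by split; rewrite E.
Qed.

Lemma Ck_on_cst k U (a : R) : Ck_on k U (cst a).
Proof.
elim: k a => [|k IH] a; first by move=> x _; exact: cst_continuous.
split=> [x _|v]; first exact: differentiable_cst.
rewrite (_ : (fun x => _) = cst 0); first exact: IH.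
by apply/funext => x; rewrite derive_cst.
Qed.

Lemma Ck_onD k U f g : open U ->
  Ck_on k U f -> Ck_on k U g -> Ck_on k U (fun x => f x + g x).
Proof.
move=> oU; elim: k f g => [|k IH] f g.
  by move=> cf cg x Ux; apply: cvgD; [apply: cf|apply: cg].
move=> [df Df] [dg Dg]; split=> [x Ux|v].
  by apply: differentiableD; [apply: df|apply: dg].
apply: Ck_on_eq (IH _ _ (Df v) (Dg v)) => // x Ux; apply/esym.
by apply: deriveD; apply: diff_derivable; [apply: df|apply: dg].
Qed.

Lemma Ck_onM k U f g : open U ->
  Ck_on k U f -> Ck_on k U g -> Ck_on k U (fun x => f x * g x).
Proof.
move=> oU; elim: k f g => [|k IH] f g.
  by move=> cf cg x Ux; apply: cvgM; [apply: cf|apply: cg].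
move=> Cf Cg; have [[df Df] [dg Dg]] := (Cf, Cg); split=> [x Ux|v].
  by apply: differentiableM; [apply: df|apply: dg].
apply: (@Ck_on_eq _ _ (fun x => f x * 'D_v g x + g x * 'D_v f x)) => //.
  move=> x Ux; apply/esym.
  by apply: deriveM; apply: diff_derivable; [apply: df|apply: dg].
apply: Ck_onD => //.
  exact: IH (Ck_onW Cf) (Dg v).
exact: IH (Ck_onW Cg) (Df v).
Qed.

Lemma Ck_onV k U f : open U -> (forall x, U x -> f x != 0) ->
  Ck_on k U f -> Ck_on k U (fun x => (f x)^-1).
Proof.
move=> oU f0; elim: k => [|k IH].
  by move=> cf x Ux; apply: cvgV; [apply: f0|apply: cf].
move=> Cf; have [df Df] := Cf; split=> [x Ux|v].
  by apply: differentiableV; [apply: df|apply: f0].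
have CV := IH (Ck_onW Cf).
(* The derivative of [1/f] is written with two factors [1/f], so that the
   induction hypothesis applies to each. *)
apply: (@Ck_on_eq _ _ (fun x => (-1 * ((f x)^-1 * (f x)^-1)) * 'D_v f x)) => //.
  move=> x Ux; rewrite deriveV; [|exact: f0|exact/diff_derivable/df].
  by rewrite mulN1r -invfM -expr2.
apply: Ck_onM (Df v) => //; apply: Ck_onM => //; first exact: Ck_on_cst.
exact: Ck_onM.
Qed.

Lemma Ck_on_sum k U n (h : 'I_n -> V -> R) : open U ->
  (forall i, Ck_on k U (h i)) -> Ck_on k U (fun x => \sum_(i < n) h i x).
Proof.
move=> oU; elim: n h => [|n IH] h Ch.
  by under eq_fun do rewrite big_ord0; exact: Ck_on_cst.
under eq_fun do rewrite big_ord_recl.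
by apply: Ck_onD => //; apply: IH => i; exact: Ch.
Qed.

End Ck_calculus.

Lemma Ck_on_comp_snd (R : realType) (V W : normedModType R) k (U : set W)
    (f : W -> R) :
  Ck_on k U f -> Ck_on k ([set: V] `*` U) (fun p : V * W => f p.2).
Proof.
elim: k f => [|k IH] f.
  move=> cf [t x] [_ /= Ux]; apply: (@continuous_comp _ _ _ snd f).
    exact: cvg_snd.
  exact: cf.
case=> df Df; split=> [[t x] [_ /= Ux]|[s v]]; last exact: (IH _ (Df v)).
apply: (@differentiable_comp _ _ _ _ snd f); last exact: df.
by apply: linear_differentiable => q; exact: cvg_snd.
Qed.

Lemma Ck_on_fst (R : realType) (V : normedModType R) k (U : set (R * V)) :
  Ck_on k U fst.
Proof.
case: k => [|k]; first by move=> p _; exact: cvg_fst.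
split=> [p _|[s v]].
  by apply: linear_differentiable => q; exact: cvg_fst.
rewrite (_ : (fun x => _) = cst s); first exact: Ck_on_cst.
apply/funext => p /=; rewrite deriveE.
  by rewrite diff_lin // => q; exact: cvg_fst.
by apply: linear_differentiable => q; exact: cvg_fst.
Qed.


(** * Second differences and the Laplacian *)

Section along_a_line.
Context {R : realType} {V : normedModType R}.
Implicit Types (w : V -> R) (x v : V).

Lemma is_derive_line w x v (s : R) : derivable w (x + s *: v) v ->
  is_derive s 1 (fun t : R => w (x + t *: v)) ('D_v w (x + s *: v)).
Proof.
have E : (fun h : R => h^-1 *: (w (x + (h *: 1 + s) *: v) - w (x + s *: v))) =
         (fun h : R => h^-1 *: (w (h *: v + (x + s *: v)) - w (x + s *: v))).
  by apply/funext => h; rewrite [h *: 1]mulr1 scalerDl addrCA.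
by move=> dw; split; rewrite /derivable /derive /= E.
Qed.

Lemma MVT_line w x v :
  (forall s : R, 0 <= s <= 1 -> differentiable w (x + s *: v)) ->
  exists2 c : R, 0 <= c <= 1 & w (x + v) - w x = 'D_v w (x + c *: v).
Proof.
move=> dw.
have der (s : R) : 0 <= s <= 1 ->
    is_derive s 1 (fun t : R => w (x + t *: v)) ('D_v w (x + s *: v)).
  by move=> s01; apply: is_derive_line; apply: diff_derivable; exact: dw.
have [s||c] := @MVT_segment R (fun t => w (x + t *: v))
    (fun t => 'D_v w (x + t *: v)) 0 1 ler01.
- by rewrite in_itv /= => /andP[s0 s1]; apply: der; rewrite !ltW.
- apply: derivable_within_continuous => s.
  by rewrite in_itv /= => /der [].
by rewrite in_itv /= subr0 mulr1 scale1r scale0r addr0 => c01 E; exists c.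
Qed.

(** The expected value [d2 * s ^+ 2] is subtracted from the second difference before
the mean value theorem is applied: the derivative of the result in [s] is [o(s)],
because [d2] is the derivative of ['D_v w] at [x]. *)
Lemma second_diff_line_cvg (U : set V) w x v :
  open U -> U x -> Ck_on 2 U w ->
  (w (x + t *: v) + w (x - t *: v) - 2 * w x) / t ^+ 2 @[t --> 0^']
    --> 'D_v (fun y => 'D_v w y) x.
Proof.
move=> oU Ux [dw /(_ v) [dDw _]].
set D := fun y => 'D_v w y; set d2 := 'D_v D x.
have /cvgrPdist_le dD : derivable D x v by exact/diff_derivable/dDw.
apply/cvgrPdist_le => e e0.
have {dD} nD : \forall s \near 0, `|D (x + s *: v) - D x - s * d2| <= e / 2 * `|s|.
  have e2 : 0 < e / 2 by rewrite divr_gt0.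
  have := dD _ e2; rewrite near_withinE; apply: filterS => s /= Hs.
  have [->|s0] := eqVneq s 0.
    by rewrite scale0r addr0 subrr mul0r subrr !normr0 mulr0.
  have := Hs s0; rewrite -(ler_pM2r (_ : 0 < `|s|)) ?normr_gt0 // -normrM.
  rewrite distrC mulrBl [_ *: _]mulrC mulfVK // (addrC x); congr (`|_ - _| <= _).
  by rewrite mulrC.
have nU : \forall s \near 0, U (x + s *: v).
  have c : x + s *: v @[s --> (0 : R)] --> x.
    rewrite -[X in _ --> X]addr0 -(scale0r v).
    by apply: cvgD; [exact: cvg_cst|apply: cvgZr_tmp; exact: cvg_id].
  by apply: c; exact: open_nbhs_nbhs (conj oU Ux).
have [d d0 Hd] : exists2 d : R, 0 < d & forall s : R, `|s| < d ->
    U (x + s *: v) /\ `|D (x + s *: v) - D x - s * d2| <= e / 2 * `|s|.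
  have /nbhs_ballP[d d0 Hd] : nbhs (0 : R) (fun s => U (x + s *: v) /\
      `|D (x + s *: v) - D x - s * d2| <= e / 2 * `|s|) by exact: filterI.
  by exists d => // s sd; apply: Hd; rewrite /ball /= sub0r normrN.
(* The second difference is even in [t], hence positive [t] suffice. *)
have pos t : 0 < t -> t < d ->
    `|d2 - (w (x + t *: v) + w (x - t *: v) - 2 * w x) / t ^+ 2| <= e.
  move=> t0 td.
  pose phi s := w (x + s *: v) + w (x + s *: - v) - d2 * s ^+ 2.
  pose dphi s := D (x + s *: v) - D (x + s *: - v) - d2 * (2 * s).
  have sd s : 0 <= s <= t -> `|s| < d /\ `|- s| < d.
    by move=> /andP[s0 st]; rewrite normrN ger0_norm // (le_lt_trans st).
  have DN y : U y -> 'D_(- v) w y = - D y.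
    by move=> Uy; rewrite /D !deriveE; [exact: linearN|exact: dw|exact: dw].
  have dphiE s : 0 <= s <= t -> is_derive s 1 phi (dphi s).
    move=> st; have [Us _] := Hd _ (sd s st).1.
    have [Us' _] := Hd _ (sd s st).2.
    rewrite scaleNr -scalerN in Us'.
    have d1 := @is_derive_line w x v s (diff_derivable (dw _ Us)).
    have d2' := @is_derive_line w x (- v) s (diff_derivable (dw _ Us')).
    have -> : dphi s = 'D_v w (x + s *: v) + 'D_(- v) w (x + s *: - v) - d2 * (2 * s).
      by rewrite /dphi DN.
    apply: is_deriveB.
    have dsq : is_derive s 1 (fun s : R => s ^+ 2) (2 * s).
      have := @is_deriveX _ _ id 2 s 1 1 (is_derive_id _ _).
      by rewrite exprfctE /= expr1 [_ *: 1]mulr1.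
    exact: (@is_deriveZ _ _ _ (fun s : R => s ^+ 2 : R^o) d2 s 1 (2 * s) dsq).
  have [s||c /= ct] := @MVT_segment R phi dphi 0 t (ltW t0).
  - by rewrite in_itv /= => /andP[s0 st]; apply: dphiE; rewrite !ltW.
  - by apply: derivable_within_continuous => s; rewrite in_itv /= => /dphiE[].
  move: ct; rewrite in_itv /= => ct.
  rewrite /phi !scale0r !addr0 expr0n /= mulr0 !subr0 => E.
  have [_ B1] := Hd _ (sd c ct).1.
  have [_ B2] := Hd _ (sd c ct).2.
  have /andP[c0 ct'] := ct.
  rewrite ?normrN (ger0_norm c0) in B1 B2.
  have B : `|dphi c| <= e * t.
    rewrite (_ : dphi c = D (x + c *: v) - D x - c * d2
      - (D (x + - c *: v) - D x - - c * d2)); last first.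
      by rewrite /dphi scaleNr -scalerN; ring.
    apply: le_trans (ler_normB _ _) _.
    apply: le_trans (lerD B1 B2) _; rewrite -mulrDl -splitr.
    by rewrite ler_pM2l.
  rewrite distrC.
  rewrite (_ : _ - d2 = (w (x + t *: v) + w (x + t *: - v) - d2 * t ^+ 2
    - (w x + w x)) / t ^+ 2); last first.
    by rewrite scalerN; field; rewrite gt_eqF.
  rewrite E normrM normfV (ger0_norm (sqr_ge0 _)) ler_pdivrMr ?exprn_gt0 //.
  by rewrite normrM (gtr0_norm t0) expr2 mulrA ler_pM2r.
near=> t.
have t0 : t != 0 by near: t; exact: nbhs_dnbhs_neq.
have td : `|t| < d.
  near: t; apply: nbhs_dnbhs; apply/nbhs_ballP; exists d => // s.
  by rewrite /ball /= sub0r normrN.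
have := pos `|t|; rewrite normr_gt0 t0 => /(_ isT td).
have [_|_] := ger0P t; first by [].
by rewrite sqrrN scaleNr opprK (addrC (w (x - _))).
Unshelve. all: by end_near. Qed.
End along_a_line.

Definition second_diff {R : realType} {m : nat} (w : 'rV[R]_m -> R)
    (x : 'rV[R]_m) (t : R) : R :=
  \sum_(i < m) (w (x + t *: delta_mx 0 i) + w (x - t *: delta_mx 0 i) - 2 * w x).

(** A pointwise Laplacian that does not require second derivatives.  Symmetric
differences are used because they are invariant under reflections and are
nonpositive at a maximum. *)
Definition has_laplacian {R : realType} {m : nat} (w : 'rV[R]_m -> R)
    (x : 'rV[R]_m) (l : R) : Prop :=
  second_diff w x t / t ^+ 2 @[t --> 0^'] --> l.

Section has_laplacian_theory.
Context {R : realType} {m : nat}.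
Implicit Types (w f : 'rV[R]_m -> R) (x v : 'rV[R]_m) (U : set 'rV[R]_m).

Lemma Ck2_has_laplacian U w x :
  open U -> U x -> Ck_on 2 U w -> has_laplacian w x (laplacian w x).
Proof.
move=> oU Ux Cw; rewrite /has_laplacian /second_diff.
under eq_fun do rewrite mulr_suml.
apply: cvg_big => [|i _]; first exact: add_continuous.
exact: second_diff_line_cvg oU Ux Cw.
Qed.

Lemma has_laplacianB w f x l l' : has_laplacian w x l -> has_laplacian f x l' ->
  has_laplacian (fun y => w y - f y) x (l - l').
Proof.
move=> hw hf; apply: cvg_trans (cvgB hw hf); apply: near_eq_cvg.
apply: nearW => t /=; rewrite !fctE -mulrBl; congr (_ * _).
by rewrite /second_diff -sumrB; apply: eq_bigr => i _; ring.
Qed.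

Lemma has_laplacianN w x l : has_laplacian w x l ->
  has_laplacian (fun y => - w y) x (- l).
Proof.
move=> hw; apply: cvg_trans (cvgN hw); apply: near_eq_cvg.
apply: nearW => t /=; rewrite !fctE -mulNr; congr (_ * _).
by rewrite /second_diff -sumrN; apply: eq_bigr => i _; ring.
Qed.

Lemma has_laplacianZ (k : R) w x l : has_laplacian w x l ->
  has_laplacian (fun y => k * w y) x (k * l).
Proof.
move=> hw; have kw : k * (second_diff w x t / t ^+ 2) @[t --> 0^'] --> k * l.
  exact: cvgMl_tmp.
rewrite /has_laplacian; apply: cvg_trans kw; apply: near_eq_cvg.
apply: nearW => t /=; rewrite mulrA; congr (_ * _).
by rewrite /second_diff mulr_sumr; apply: eq_bigr => i _; ring.
Qed.

Lemma has_laplacian_shift v w x l : has_laplacian w (x + v) l ->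
  has_laplacian (fun y => w (y + v)) x l.
Proof.
rewrite /has_laplacian => hw; apply: cvg_trans hw; apply: near_eq_cvg; apply: nearW => t /=.
rewrite /second_diff; congr (_ / _).
by apply: eq_bigr => i _; rewrite !(addrAC x v).
Qed.

End has_laplacian_theory.

(** * The maximum principle on a half cube *)

Section row_vectors.
Context {R : realType} {m : nat}.
Implicit Types (x y : 'rV[R]_m) (e : R).

Lemma rV_norm_leP x e : 0 <= e -> (`|x| <= e) <-> (forall j, `|x 0 j| <= e).
Proof.
move=> e0; rewrite -[`|x|]/(mx_norm x) mx_normrE; split=> [/bigmax_leP[_ h] j|h].
  exact: (h (0, j)).
by apply/bigmax_leP; split=> // -[i j] _; rewrite ord1; exact: h.
Qed.

Lemma rV_norm_ltP x e : 0 < e -> (`|x| < e) <-> (forall j, `|x 0 j| < e).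
Proof.
move=> e0; rewrite -[`|x|]/(mx_norm x) mx_normrE; split=> [/bigmax_ltP[_ h] j|h].
  exact: (h (0, j)).
by apply/bigmax_ltP; split=> // -[i j] _; rewrite ord1; exact: h.
Qed.

Lemma norm_coord_le x j : `|x 0 j| <= `|x|.
Proof. by have [h _] := rV_norm_leP x (normr_ge0 x); exact: h. Qed.

Lemma add_deltaE x (t : R) (j k : 'I_m) :
  (x + t *: delta_mx 0 j) 0 k = x 0 k + t * (k == j)%:R.
Proof. by rewrite !mxE eqxx. Qed.

Lemma norm_scale_delta (t : R) (j : 'I_m) : `|t *: (delta_mx 0 j : 'rV[R]_m)| <= `|t|.
Proof.
apply/rV_norm_leP => // k; rewrite !mxE /=.
by case: (_ == _); rewrite ?mulr1 // mulr0 normr0.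
Qed.

Lemma dot_ge0 x : 0 <= dot x x.
Proof. by apply: sumr_ge0 => j _; rewrite -expr2 sqr_ge0. Qed.

Lemma sqr_coord_le_dot x j : x 0 j ^+ 2 <= dot x x.
Proof.
rewrite /dot (bigD1 j) //= -expr2 lerDl.
by apply: sumr_ge0 => k _; rewrite -expr2 sqr_ge0.
Qed.

End row_vectors.

(** The comparison function is [psi = A |y|^2 + C y_i (d - y_i)], where
[y = x - z], on the half cube [K] where [|y| <= d] and [0 <= y_i].
- The coefficient [C] is chosen to make the Laplacian of [psi] equal to
  [2mA - 2C = -N].
- The coefficient [A] makes [psi >= M] on the faces where some [|y_j|] is [d].
On the face [y_i = 0] the odd part of [w] vanishes.  So the odd part of [w] minus
[psi] is nonpositive on the boundary of [K], and its Laplacian is positive inside,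
which excludes a positive maximum. *)
Section comparison.
Context {R : realType} {m : nat}.
Implicit Types (x p : 'rV[R]_m) (t : R) (j k : 'I_m).
Variables (w gw : 'rV[R]_m -> R) (z : 'rV[R]_m) (i : 'I_m) (d M N : R).
Hypothesis d0 : 0 < d.
Hypothesis cw : forall x, `|x - z| <= d -> {for x, continuous w}.
Hypothesis lw : forall x, `|x - z| <= d -> has_laplacian w x (gw x).
Hypothesis wM : forall x, `|x - z| <= d -> `|w x| <= M.
Hypothesis gN : forall x, `|x - z| <= d -> `|gw x| < N.

Let A := M / d ^+ 2.
Let C := m%:R * A + N / 2.
Let refl x : 'rV[R]_m := x - (2 * (x 0 i - z 0 i)) *: delta_mx 0 i.
Let psi x := A * dot (x - z) (x - z)
             + C * ((x 0 i - z 0 i) * (d - (x 0 i - z 0 i))).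
Let v x := (w x - w (refl x)) / 2 - psi x.
Let K := [set x : 'rV[R]_m | `|x - z| <= d /\ 0 <= x 0 i - z 0 i].

Let z_in : `|z - z| <= d. Proof. by rewrite subrr normr0 ltW. Qed.
Let M0 : 0 <= M. Proof. exact: le_trans (normr_ge0 _) (wM z_in). Qed.
Let N0 : 0 < N. Proof. exact: le_lt_trans (normr_ge0 _) (gN z_in). Qed.
Let A0 : 0 <= A. Proof. by rewrite divr_ge0 ?sqr_ge0. Qed.
Let AC : A <= C.
Proof.
have m1 : 1 <= m%:R :> R by rewrite ler1n (leq_ltn_trans _ (ltn_ord i)).
rewrite /C; apply: (@le_trans _ _ (m%:R * A)); first by rewrite ler_peMl.
by rewrite lerDl divr_ge0 ?ltW.
Qed.
Let C0 : 0 <= C. Proof. exact: le_trans AC. Qed.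

Let reflE x k : (refl x) 0 k - z 0 k = (x 0 k - z 0 k) * (-1) ^+ (k == i).
Proof.
rewrite /refl !mxE eqxx /=; case: eqVneq => [->|_] /=.
  by rewrite expr1; ring.
by rewrite expr0; ring.
Qed.

Let refl_norm x : `|x - z| <= d -> `|refl x - z| <= d.
Proof.
move/(rV_norm_leP _ (ltW d0)) => h; apply/(rV_norm_leP _ (ltW d0)) => k.
rewrite !mxE -/(refl x 0 k).
have := reflE x k; rewrite {1}/refl !mxE eqxx /= => ->.
by rewrite normrM normrX normrN1 expr1n mulr1; have := h k; rewrite !mxE.
Qed.

Let reflD x (t : R) j : refl (x + t *: delta_mx 0 j)
  = refl x + ((-1) ^+ (j == i) * t) *: delta_mx 0 j.
Proof.
apply/rowP => k; rewrite !mxE !eqxx /=.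
rewrite (eq_sym j); case: (eqVneq i j) => [->|ij] /=.
  by case: eqVneq => [->|_] /=; rewrite ?expr1; ring.
by rewrite expr0; ring.
Qed.

Let psi_second_diff x t : second_diff psi x t = - N * t ^+ 2.
Proof.
have H j : psi (x + t *: delta_mx 0 j) + psi (x - t *: delta_mx 0 j) - 2 * psi x
    = (2 * A - 2 * C * (i == j)%:R) * t ^+ 2.
  have Hd (s : R) : dot (x + s *: delta_mx 0 j - z) (x + s *: delta_mx 0 j - z)
      = dot (x - z) (x - z) + 2 * s * (x 0 j - z 0 j) + s ^+ 2.
    rewrite /dot (bigD1 j) //= [in RHS](bigD1 j) //= !mxE !eqxx /=.
    rewrite (eq_bigr (fun k => (x - z) 0 k * (x - z) 0 k)); first by ring.
    by move=> k /negPf kj; rewrite !mxE kj andbF mulr0 addr0.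
  rewrite /psi -scaleNr !Hd !add_deltaE; case: (i == j) => /=; ring.
rewrite /second_diff (eq_bigr _ (fun j _ => H j)) -mulr_suml; congr (_ * _).
rewrite sumrB -mulr_sumr big_const_ord iter_addr_0.
rewrite (bigD1 i) //= eqxx big1 ?addr0; last first.
  by move=> j /negPf ji; rewrite eq_sym ji mulr0.
by rewrite /C -[A *+ m]mulr_natl /= mulr1; field.
Qed.

Let v_second_diff x t : second_diff v x t =
  (second_diff w x t - second_diff w (refl x) t) / 2 + N * t ^+ 2.
Proof.
rewrite -[N]opprK mulNr -(psi_second_diff x) /second_diff -!sumrB mulr_suml -sumrB.
apply: eq_bigr => j _; rewrite /v -[- (t *: delta_mx _ _)]scaleNr !reflD.
by case: (j == i); rewrite /= ?(expr1, expr0, mul1r, mulN1r, opprK); field.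
Qed.

Let v_max_le0 p : K p -> (forall x, K x -> v x <= v p) -> v p <= 0.
Proof.
move=> [pd pi0] vmax; rewrite leNgt; apply/negP => vp.
have psi_ge : A * dot (p - z) (p - z) <= psi p.
  rewrite lerDl mulr_ge0 // mulr_ge0 // subr_ge0.
  have := norm_coord_le (p - z) i; rewrite !mxE => h.
  exact: le_trans (ler_norm _) (le_trans h pd).
(* A positive maximum cannot lie on the boundary of [K]: there the values of [psi]
   are too large, or the odd part vanishes. *)
have psiM : psi p < M.
  have := vp; rewrite /v subr_gt0 => /lt_le_trans; apply.
  rewrite ler_pdivrMr // mulr_natr mulr2n.
  apply: le_trans (ler_norm _) (le_trans (ler_normB _ _) _).
  by apply: lerD; apply: wM => //; exact: refl_norm.
have AM : A * d ^+ 2 = M by rewrite /A mulfVK // expf_neq0 // gt_eqF.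
have pd' : `|p - z| < d.
  apply/(rV_norm_ltP _ d0) => k; rewrite ltNge; apply/negP => dk.
  have : M <= psi p; last by rewrite leNgt psiM.
  rewrite -AM (le_trans _ psi_ge) // ler_wpM2l //.
  apply: le_trans (sqr_coord_le_dot _ k).
  by rewrite -(real_normK (num_real ((p - z) 0 k))) lerXn2r // nnegrE ltW.
have pi1 : 0 < p 0 i - z 0 i.
  rewrite lt_def pi0 andbT; apply/eqP => pi_eq.
  have : v p <= 0; last by rewrite leNgt vp.
  rewrite /v /refl pi_eq mulr0 scale0r subr0 subrr mul0r sub0r oppr_le0.
  by rewrite (le_trans _ psi_ge) // mulr_ge0 // dot_ge0.
(* At the interior maximum all second differences are nonpositive; in the limit
   this contradicts the bound [N] on the Laplacian of [w]. *)
have nv : \forall t \near 0^', (second_diff w p t / t ^+ 2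
    - second_diff w (refl p) t / t ^+ 2) / 2 + N <= 0.
  near=> t.
  have t0 : t != 0 by near: t; exact: nbhs_dnbhs_neq.
  have td : `|t| < d - `|p - z|.
    near: t; apply: nbhs_dnbhs; apply/nbhs_ballP; exists (d - `|p - z|).
      by rewrite /= subr_gt0.
    by move=> s; rewrite /ball /= sub0r normrN.
  have ti : `|t| < p 0 i - z 0 i.
    near: t; apply: nbhs_dnbhs; apply/nbhs_ballP; exists (p 0 i - z 0 i) => //.
    by move=> s; rewrite /ball /= sub0r normrN.
  have Kt s j : `|s| = `|t| -> K (p + s *: delta_mx 0 j).
    move=> st; split.
      rewrite addrAC; apply: le_trans (ler_normD _ _) _; rewrite -lerBrDl.
      by apply: le_trans (norm_scale_delta _ _) _; rewrite st ltW.
    rewrite add_deltaE addrAC -[_ * _]opprK subr_ge0.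
    apply: le_trans (ltW ti); apply: le_trans (ler_norm _) _.
    by rewrite normrN normrM st ler_piMr //; case: eqP; rewrite ?normr1 ?normr0.
  have : second_diff v p t <= 0.
    apply: sumr_le0 => j _; rewrite subr_le0 mulr_natl mulr2n -scaleNr.
    by apply: lerD; apply: vmax; apply: Kt; rewrite ?normrN.
  rewrite v_second_diff; have t2 : 0 < t ^+ 2 by rewrite exprn_even_gt0.
  rewrite -(ler_pM2r (_ : 0 < (t ^+ 2)^-1)) ?invr_gt0 // mul0r.
  congr (_ <= _); field; exact: t0.
have lim : (second_diff w p t / t ^+ 2
    - second_diff w (refl p) t / t ^+ 2) / 2 + N @[t --> 0^'] -->
    (gw p - gw (refl p)) / 2 + N.
  apply: cvgD; last exact: cvg_cst.
  apply: cvgMr_tmp; apply: cvgB; apply: lw => //; exact: refl_norm.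
have : (gw p - gw (refl p)) / 2 + N <= 0.
  by rewrite -(cvg_lim _ lim) //; apply: limr_le => //; apply/cvg_ex; eexists; exact: lim.
have := gN pd; have := gN (refl_norm pd).
by rewrite !ltr_norml => /andP[h1 h2] /andP[h3 h4]; lra.
Unshelve. all: by end_near. Qed.
Let K_compact : compact K.
Proof.
apply: bounded_closed_compact.
  exists (`|z| + d); split; first exact: num_real.
  move=> e /ltW ze x [xd _]; apply: le_trans ze.
  by rewrite -[x](subrK z) addrC; apply: le_trans (ler_normD _ _) _; rewrite lerD2l.
have -> : K = closed_ball_ Num.norm z d `&` (fun x => x 0 i) @^-1` [set y | z 0 i <= y].
  by apply/seteqP; split=> x /=; rewrite /K /closed_ball_ /= distrC subr_ge0.
apply: closedI; first exact: closed_closed_ball_.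
by apply: closed_comp => [x _|]; [exact: coord_continuous|exact: closed_ge].
Qed.

Let coord_sub_continuous j : continuous (fun x => x 0 j - z 0 j).
Proof.
move=> x; apply: (@cvgB _ _ _ (nbhs x) _ (fun y => y 0 j) (fun=> z 0 j)).
  exact: coord_continuous.
exact: cvg_cst.
Qed.

Let refl_continuous : continuous refl.
Proof.
move=> x; apply: (@cvgB _ 'rV[R]_m _ (nbhs x) _ id
  (fun y => (2 * (y 0 i - z 0 i)) *: delta_mx 0 i)); first exact: cvg_id.
apply: (@cvgZr_tmp _ _ _ (nbhs x) _ (fun y => 2 * (y 0 i - z 0 i))).
apply: (@cvgMl_tmp _ _ (nbhs x) _ (fun y => y 0 i - z 0 i)).
exact: coord_sub_continuous.
Qed.

Let psi_continuous : continuous psi.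
Proof.
move=> x; apply: (@cvgD _ _ _ (nbhs x) _ (fun y => A * dot (y - z) (y - z))
  (fun y => C * ((y 0 i - z 0 i) * (d - (y 0 i - z 0 i))))).
  apply: cvgMl_tmp; rewrite /dot; apply: cvg_big => [|j _].
    exact: add_continuous.
  under eq_fun do rewrite !mxE; rewrite !mxE.
    apply: (@cvgM _ _ (nbhs x) _ (fun y => y 0 j - z 0 j)
      (fun y => y 0 j - z 0 j)); exact: coord_sub_continuous.
apply: cvgMl_tmp; apply: cvgM; first exact: coord_sub_continuous.
by apply: cvgB; [exact: cvg_cst|exact: coord_sub_continuous].
Qed.

Let v_le0 x : K x -> v x <= 0.
Proof.
have Kz : K z by split; rewrite // subrr.
have [||p Kp pmax] := @EVT_max_rV R m v K _ K_compact; first by exists z.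
  apply: continuous_in_subspaceT => y; rewrite inE => -[yd _].
  apply: (@cvgB _ _ _ (nbhs y) _ (fun x => (w x - w (refl x)) / 2) psi);
    last exact: psi_continuous.
  apply: (@cvgMr_tmp _ _ (nbhs y) _ (fun x => w x - w (refl x))).
  apply: (@cvgB _ _ _ (nbhs y) _ w (w \o refl)); first exact: cw.
  apply: continuous_comp; first exact: refl_continuous.
  by apply: cw; exact: refl_norm.
rewrite inE in Kp => Kx.
have pm y : K y -> v y <= v p by move=> Ky; apply: pmax; rewrite inE.
exact: le_trans (pm _ Kx) (v_max_le0 Kp pm).
Qed.

Lemma odd_difference_le (s : R) : 0 <= s <= d ->
  w (z + s *: delta_mx 0 i) - w (z - s *: delta_mx 0 i)
    <= 2 * s * ((m%:R * (M / d ^+ 2) + N / 2) * d).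
Proof.
move=> /andP[s0 sd]; rewrite -/A -/C.
have E : (z + s *: delta_mx 0 i) 0 i - z 0 i = s.
  by rewrite add_deltaE eqxx mulr1 addrC addKr.
have Ks : K (z + s *: delta_mx 0 i).
  split; last by rewrite E.
  rewrite addrC addKr; apply: le_trans (norm_scale_delta _ _) _.
  by rewrite ger0_norm.
have := v_le0 Ks; rewrite /v /psi /refl E.
have -> : z + s *: delta_mx 0 i - (2 * s) *: delta_mx 0 i
    = z - s *: delta_mx 0 i :> 'rV[R]_m.
  by apply/rowP => k; rewrite !mxE; ring.
have -> : dot (z + s *: delta_mx 0 i - z) (z + s *: delta_mx 0 i - z) = s ^+ 2.
  rewrite addrC addKr /dot (bigD1 i) //= big1 ?addr0; last first.
    by move=> j /negPf ji; rewrite !mxE eqxx ji mulr0 mul0r.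
  by rewrite !mxE !eqxx mulr1 expr2.
have : A * s ^+ 2 <= C * s ^+ 2 by rewrite ler_wpM2r ?sqr_ge0.
move: (w _) (w _) => w1 w2; lra.
Qed.

End comparison.

(** The opposite inequality is the same one for [- w]. *)
Lemma odd_difference_norm_le (R : realType) (m : nat) (w gw : 'rV[R]_m -> R)
    (z : 'rV[R]_m) (i : 'I_m) (d M N s : R) : 0 < d ->
  (forall x, `|x - z| <= d -> {for x, continuous w}) ->
  (forall x, `|x - z| <= d -> has_laplacian w x (gw x)) ->
  (forall x, `|x - z| <= d -> `|w x| <= M) ->
  (forall x, `|x - z| <= d -> `|gw x| < N) ->
  0 <= s <= d ->
  `|w (z + s *: delta_mx 0 i) - w (z - s *: delta_mx 0 i)|
    <= 2 * s * ((m%:R * (M / d ^+ 2) + N / 2) * d).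
Proof.
move=> d0 cw lw wM gN s0d; rewrite ler_norml.
rewrite (odd_difference_le i d0 cw lw wM gN s0d) andbT lerNl opprB.
have := @odd_difference_le R m (fun x => - w x) (fun x => - gw x) z i d M N d0.
move=> /(_ _ _ _ _ s); rewrite opprK addrC; apply => // x xd; last 2 first.
- by rewrite normrN wM.
- by rewrite normrN gN.
- by apply: (@cvgN _ _ _ (nbhs x) _ w); exact: cw.
- by apply: has_laplacianN; exact: lw.
Qed.


(** * Interior Lipschitz estimate *)

(** The constant of the one-coordinate estimate in a cube of half-side [rho / 2],
multiplied by [m] because a displacement is made of [m] coordinate moves. *)
Definition lipschitz_const {R : realType} (m : nat) (rho : R) : R :=
  m%:R * ((m%:R / (rho / 2) ^+ 2 + 1 / 2) * (rho / 2)).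

Lemma lipschitz_const_ge0 {R : realType} (m : nat) (rho : R) :
  0 < rho -> 0 <= lipschitz_const m rho.
Proof.
move=> r0; have r1 : 0 <= rho / 2 by rewrite divr_ge0 ?ltW.
apply: mulr_ge0 => //; apply: mulr_ge0 => //.
by rewrite addr_ge0 ?divr_ge0 ?exprn_ge0.
Qed.

(** The path from [x] to [y] changes the coordinates one at a time.  Its vertices
stay in the half ball, which is a cube, and each edge is bounded by
[odd_difference_norm_le] about the midpoint of the edge; the cube of half-side
[rho / 2] about that midpoint stays in the large ball. *)
Lemma lipschitz_half_ball {R : realType} {m : nat} (w gw : 'rV[R]_m -> R)
    (x0 : 'rV[R]_m) (rho eta : R) : 0 < rho ->
  (forall x, `|x - x0| < rho -> {for x, continuous w}) ->
  (forall x, `|x - x0| < rho -> has_laplacian w x (gw x)) ->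
  (forall x, `|x - x0| < rho -> `|w x| <= eta) ->
  (forall x, `|x - x0| < rho -> `|gw x| < eta) ->
  forall x y, `|x - x0| < rho / 2 -> `|y - x0| < rho / 2 ->
    `|w y - w x| <= lipschitz_const m rho * eta * `|y - x|.
Proof.
move=> r0 cw lw wM gN x y xr yr.
set d := rho / 2; have d0 : 0 < d by rewrite divr_gt0.
pose p (k : nat) : 'rV[R]_m := \row_j (if (j < k)%N then y 0 j else x 0 j).
have p0 : p 0%N = x by apply/rowP => j; rewrite mxE.
have pm : p m = y by apply/rowP => j; rewrite mxE ltn_ord.
have step (k : 'I_m) : `|w (p k.+1) - w (p k)| <=
    (m%:R / d ^+ 2 + 1 / 2) * d * eta * `|y - x|.
  pose tau := (y 0 k - x 0 k) / 2.
  pose z : 'rV[R]_m := p k + tau *: delta_mx 0 k.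
  have zr : `|z - x0| < d.
    apply/(rV_norm_ltP _ d0) => j; rewrite !mxE /=.
    have /(rV_norm_ltP _ d0)/(_ j) := xr; have /(rV_norm_ltP _ d0)/(_ j) := yr.
    rewrite !mxE; have [->|jk] := eqVneq j k; rewrite /= ?ltnn ?mulr1 ?mulr0 ?addr0.
      by rewrite /tau !ltr_norml => /andP[? ?] /andP[? ?]; apply/andP; split; lra.
    by case: ifP.
  have zin u : `|u - z| <= d -> `|u - x0| < rho.
    move=> uz; rewrite -(subrK z u) -addrA (splitr rho).
    by apply: le_lt_trans (ler_normD _ _) _; rewrite ler_ltD.
  have pk : p k = z - tau *: delta_mx 0 k by rewrite /z addrK.
  have pk1 : p k.+1 = z + tau *: delta_mx 0 k.
    apply/rowP => j; rewrite !mxE eqxx /= ltnS leq_eqVlt.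
    have [->|jk] := eqVneq j k; first by rewrite eqxx ltnn /= /tau; field.
    by rewrite val_eqE (negPf jk) /= !mulr0 !addr0.
  have tk : `|tau| * 2 <= `|y - x|.
    rewrite /tau normrM [`|2^-1|]ger0_norm // mulfVK //.
    by have := norm_coord_le (y - x) k; rewrite !mxE.
  have td : 0 <= `|tau| <= d.
    rewrite normr_ge0 /= /d ler_pdivlMr //; apply: le_trans tk _.
    rewrite (splitr rho) -(subrKA x0) (le_trans (ler_normD _ _)) //.
    by apply: lerD; rewrite ltW // distrC.
  have := @odd_difference_norm_le R m w gw z k d eta eta `|tau| d0
    (fun u uz => cw u (zin u uz)) (fun u uz => lw u (zin u uz))
    (fun u uz => wM u (zin u uz)) (fun u uz => gN u (zin u uz)) td.
  have -> : `|w (z + `|tau| *: delta_mx 0 k) - w (z - `|tau| *: delta_mx 0 k)|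
      = `|w (p k.+1) - w (p k)|.
    rewrite pk1 pk; have [_|_] := ger0P tau; first by [].
    by rewrite scaleNr opprK distrC.
  move=> /le_trans; apply.
  have E : (m%:R / d ^+ 2 + 1 / 2) * d * eta * `|y - x|
    = `|y - x| * ((m%:R * (eta / d ^+ 2) + eta / 2) * d).
    by field; rewrite gt_eqF.
  rewrite E mulrC (mulrC `|y - x|) (mulrC 2); apply: ler_wpM2l => //.
  have eta0 : 0 <= eta.
    by apply: le_trans (wM x0 _); rewrite ?normr_ge0 // subrr normr0.
  apply: mulr_ge0 (ltW d0); apply: addr_ge0; last by rewrite divr_ge0.
  by rewrite mulr_ge0 // divr_ge0 ?sqr_ge0.
have -> : w y - w x = \sum_(k < m) (w (p k.+1) - w (p k)).
  by rewrite -{1}pm -{1}p0 -(telescope_sumr (fun k => w (p k))) // big_mkord.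
apply: le_trans (ler_norm_sum _ _ _) _.
apply: le_trans (ler_sum _ (fun k _ => step k)) _.
by rewrite sumr_const card_ord -[X in X <= _]mulr_natl /lipschitz_const -/d !mulrA.
Qed.

(** * Functions that are C^1 up to a small Lipschitz error *)

Section lipschitz_approximation.
Context {R : realType} {V : normedModType R}.
Variables (U : set V) (f : V -> R).
Hypothesis oU : open U.
Hypothesis approx : forall e : R, 0 < e -> exists2 w : V -> R, Ck_on 1 U w &
  forall x y, U x -> U y -> `|(f y - w y) - (f x - w x)| <= e * `|y - x|.

Let quot (g : V -> R) (x v : V) (h : R) : R := h^-1 *: (g (h *: v + x) - g x).

Let near_line x v : U x -> \forall h \near (0 : R)^', U (h *: v + x).
Proof.
move=> Ux; have c : h *: v + x @[h --> (0 : R)] --> x.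
  rewrite -[X in _ --> X]add0r -(scale0r v).
  by apply: cvgD; [apply: cvgZr_tmp; exact: cvg_id|exact: cvg_cst].
by apply: nbhs_dnbhs; apply: c; exact: open_nbhs_nbhs (conj oU Ux).
Qed.

Let near_quot (e : R) (w : V -> R) x v : U x ->
  (forall x y, U x -> U y -> `|(f y - w y) - (f x - w x)| <= e * `|y - x|) ->
  \forall h \near (0 : R)^', `|quot f x v h - quot w x v h| <= e * `|v|.
Proof.
move=> Ux H; near=> h.
have h0 : h != 0 by near: h; exact: nbhs_dnbhs_neq.
have Uh : U (h *: v + x) by near: h; exact: near_line.
rewrite /quot -scalerBr normrZ normfV ler_pdivrMl ?normr_gt0 //.
have := H _ _ Ux Uh; rewrite addrK normrZ mulrCA.
by congr (`|_| <= _); ring.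
Unshelve. all: by end_near. Qed.

(** The difference quotients of [f] are Cauchy: they stay close to those of [w],
which converge. *)
Let derivable_f x v : U x -> derivable f x v.
Proof.
move=> Ux; apply/cauchy_cvgP/cauchy_exP => e e0.
pose e' := e / 2 / (`|v| + 1).
have v1 : 0 < `|v| + 1 by rewrite ltr_wpDl.
have e'0 : 0 < e' by rewrite divr_gt0 // divr_gt0.
have [w [dw _] H] := approx e'0.
have /cvgrPdist_lt dwx : derivable w x v by exact/diff_derivable/dw.
exists ('D_v w x); have e2 : 0 < e / 2 by rewrite divr_gt0.
have := near_quot v Ux H; have := dwx _ e2; rewrite /fmap /= => Q1 Q2.
near=> h; rewrite /ball /= -(subrKA (quot w x v h)) (splitr e).
apply: le_lt_trans (ler_normD _ _) _; apply: ltr_leD.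
  by near: h; exact: Q1.
rewrite distrC; apply: (@le_trans _ _ (e' * `|v|)); first by near: h; exact: Q2.
by rewrite /e' mulrAC ler_pdivrMr // ler_pM2l // lerDl.
Unshelve. all: by end_near. Qed.

Let derive_close (e : R) (w : V -> R) x v : U x -> Ck_on 1 U w ->
  (forall x y, U x -> U y -> `|(f y - w y) - (f x - w x)| <= e * `|y - x|) ->
  `|'D_v f x - 'D_v w x| <= e * `|v|.
Proof.
move=> Ux [dw _] H.
have cf : quot f x v h @[h --> 0^'] --> 'D_v f x by exact: derivable_f.
have cw : quot w x v h @[h --> 0^'] --> 'D_v w x.
  exact: diff_derivable (dw _ Ux).
have lim : `|quot f x v h - quot w x v h| @[h --> 0^']
    --> `|'D_v f x - 'D_v w x|.
  by apply: cvg_norm; exact: cvgB.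
rewrite -(cvg_lim _ lim) //; apply: limr_le; first by apply/cvg_ex; eexists; exact: lim.
exact: near_quot.
Qed.

Let differentiable_f x : U x -> differentiable f x.
Proof.
move=> Ux; pose L v := 'D_v f x.
have linL : linear L.
  move=> a u v; apply/eqP; rewrite -subr_eq0 -normr_le0; apply/ler_addgt0Pr => e e0.
  rewrite add0r.
  pose S := `|a *: u + v| + (`|a| * `|u| + `|v|).
  have S0 : 0 <= S by rewrite /S !addr_ge0 // mulr_ge0.
  have S1 : 0 < S + 1 by rewrite ltr_wpDl.
  have [w Cw H] := approx (divr_gt0 e0 S1).
  have C z := derive_close z Ux Cw H.
  have Dw : 'D_(a *: u + v) w x = a *: 'D_u w x + 'D_v w x.
    by rewrite !deriveE ?linearP //; case: Cw => dw _; exact: dw.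
  rewrite /L (_ : _ - _ = ('D_(a *: u + v) f x - 'D_(a *: u + v) w x)
    - (a * ('D_u f x - 'D_u w x) + ('D_v f x - 'D_v w x))); last first.
    by rewrite Dw /GRing.scale /=; ring.
  apply: le_trans (ler_normB _ _) _.
  apply: le_trans (lerD (C _) (ler_normD _ _)) _.
  rewrite normrM.
  apply: le_trans (lerD (lexx _) (lerD (ler_wpM2l (normr_ge0 _) (C _)) (C _))) _.
  rewrite [X in X <= _](_ : _ = e / (S + 1) * S); last by rewrite /S; ring.
  by rewrite mulrAC ler_pdivrMr // ler_pM2l // lerDl.
pose LM := GRing.isLinear.Build _ _ _ _ _ linL.
pose Lf : {linear V -> R} := HB.pack L LM.
have cL : continuous Lf.
  have [w Cw H] := approx ltr01; have C z := derive_close z Ux Cw H.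
  have dw : differentiable w x by case: Cw => + _; apply.
  have [k k0 wk] := linear_lipschitz (diff_continuous dw).
  apply: bounded_linear_continuous; apply/linear_boundedP.
  exists (k + 1); split; first exact: num_real.
  move=> r /ltW kr z; apply: le_trans (ler_wpM2r (normr_ge0 z) kr).
  rewrite -[Lf z]/('D_z f x) -(subrK ('D_z w x) ('D_z f x)) addrC mulrDl.
  apply: le_trans (ler_normD _ _) _; apply: lerD; last exact: C.
  by rewrite deriveE.
have oL : f \o shift x = cst (f x) + Lf +o_ 0 id.
  apply/eqaddoP => e e0; have e3 : 0 < e / 3 by rewrite divr_gt0.
  have [w Cw H] := approx e3; have C z := derive_close z Ux Cw H.
  have dw : differentiable w x by case: Cw => + _; apply.
  have /diff_locallyP[_ /eqaddoP/(_ _ e3) ow] := dw.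
  have nU : \forall y \near (0 : V), U (y + x).
    have : \forall y \near x, U y by exact: open_nbhs_nbhs (conj oU Ux).
    by rewrite (near_shift 0) subr0.
  near=> h.
  have Uh : U (h + x) by near: h.
  have := H _ _ Ux Uh; rewrite addrK => H1.
  have : `|(w \o shift x - (cst (w x) + 'd w x)) h| <= e / 3 * `|h| by near: h.
  rewrite !fctE /= => H2.
  have H3 := C h; rewrite distrC deriveE // in H3.
  rewrite /L.
  rewrite (_ : _ - _ = (f (h + x) - w (h + x) - (f x - w x))
     + (w (h + x) - (w x + 'd w x h)) + ('d w x h - 'D_h f x)); last by ring.
  rewrite (_ : e * _ = e / 3 * `|h| + e / 3 * `|h| + e / 3 * `|h|); last by field.
  apply: le_trans (ler_normD _ _) _; apply: lerD => //.
  by apply: le_trans (ler_normD _ _) _; apply: lerD.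
apply/diff_locallyP; have E := diff_unique cL oL.
by rewrite E; split=> //; exact: oL.
Unshelve. all: by end_near. Qed.

(** Up to [e * |v|], the derivative of [f] along [v] is that of [w].  Linearity,
boundedness and continuity of the derivative, and the first-order expansion of
[f], all follow from those of [w] by letting [e] tend to 0. *)
Lemma Ck1_lipschitz_approx : Ck_on 1 U f.
Proof.
split=> [x Ux|v x Ux]; first exact: differentiable_f.
apply/cvgrPdist_le => e e0.
pose e' := e / 3 / (`|v| + 1).
have v1 : 0 < `|v| + 1 by rewrite ltr_wpDl.
have e3 : 0 < e / 3 by rewrite divr_gt0.
have [w Cw H] := approx (divr_gt0 e3 v1).
have C z Uz := @derive_close _ _ z v Uz Cw H.
have Cv z : U z -> `|'D_v f z - 'D_v w z| <= e / 3.
  move=> Uz; apply: le_trans (C _ Uz) _.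
  by rewrite mulrAC ler_pdivrMr // ler_pM2l // lerDl.
have [_ /(_ v x Ux)/cvgrPdist_le/(_ _ e3) cDw] := Cw.
have nU : \forall y \near x, U y by exact: open_nbhs_nbhs (conj oU Ux).
near=> y.
have Uy : U y by near: y.
rewrite (_ : _ - _ = ('D_v f x - 'D_v w x) + ('D_v w x - 'D_v w y)
  - ('D_v f y - 'D_v w y)); last by ring.
rewrite (_ : e = e / 3 + e / 3 + e / 3); last by field.
apply: le_trans (ler_normB _ _) _; apply: lerD; last exact: Cv.
apply: le_trans (ler_normD _ _) _; apply: lerD; first exact: Cv.
by near: y.
Unshelve. all: by end_near. Qed.

End lipschitz_approximation.

(** * Regularity for the Poisson equation *)

Lemma Ck_on_shift {R : realType} {V : normedModType R} k (U : set V)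
    (f : V -> R) (v : V) :
  Ck_on k U f -> Ck_on k [set x | U (x + v)] (fun x => f (x + v)).
Proof.
have cs (x : V) : {for x, continuous (fun y : V => y + v)}.
  by apply: cvgD; [exact: cvg_id|exact: cvg_cst].
elim: k f => [|k IH] f.
  by move=> cf x Ux; apply: (@continuous_comp _ _ _ (fun y => y + v) f); last exact: cf.
case=> df Df; split=> [x Ux|u].
  apply: (@differentiable_comp _ _ _ _ (fun y => y + v) f); last exact: df.
  by apply: differentiableD; last exact: differentiable_cst.
rewrite (_ : (fun x => _) = fun x => 'D_u f (x + v)); first exact: IH (Df u).
by apply/funext => x; rewrite /derive /= ; under eq_fun do rewrite -addrA.
Qed.

Section uniform_difference_quotient.
Context {R : realType} {m : nat}.

(** By the mean value theorem the error is the oscillation of the derivative near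
[x], which is locally small by continuity; compactness of the closed ball makes
it uniform. *)
Lemma difference_quotient_unif (f : 'rV[R]_m -> R) (x0 : 'rV[R]_m)
    (r rho : R) (v : 'rV[R]_m) (e : R) : 0 < r -> r < rho -> 0 < e ->
  Ck_on 1 [set x | `|x - x0| < rho] f ->
  \forall h \near (0 : R)^', forall x, `|x - x0| <= r ->
    `|h^-1 * (f (x + h *: v) - f x) - 'D_v f x| <= e.
Proof.
move=> r0 rrho e0 [df Df].
have K_compact : compact (closed_ball_ Num.norm x0 r).
  apply: bounded_closed_compact; last exact: closed_closed_ball_.
  exists (`|x0| + r); split; first exact: num_real.
  move=> e' /ltW ze x; rewrite /closed_ball_ /= distrC => xd; apply: le_trans ze.
  by rewrite -[x](subrK x0) addrC; apply: le_trans (ler_normD _ _) _; rewrite lerD2l.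
have := (compact_near_coveringP _).1 K_compact R (0 : R)^'
  (fun h x => `|h^-1 * (f (x + h *: v) - f x) - 'D_v f x| <= e) (@dnbhs_filter _ (0 : R)).
have cov x : closed_ball_ Num.norm x0 r x -> \forall x' \near x & h \near (0 : R)^',
    `|h^-1 * (f (x' + h *: v) - f x') - 'D_v f x'| <= e.
  rewrite /closed_ball_ /= distrC => xr.
  have xrho : `|x - x0| < rho by exact: le_lt_trans rrho.
  have e2 : 0 < e / 2 by rewrite divr_gt0.
  have /cvgrPdist_le/(_ _ e2) : {for x, continuous ('D_v f)} by exact: Df.
  move=> /nbhs_ballP[d1 d10 Hd1].
  pose d := Num.min d1 (rho - `|x - x0|).
  have d0 : 0 < d by rewrite lt_min subr_gt0 xrho andbT.
  have Hd y : `|y - x| < d -> `|y - x0| < rho /\ `|'D_v f x - 'D_v f y| <= e / 2.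
    rewrite lt_min => /andP[yd1 yd2]; split; last first.
      by apply: Hd1; rewrite -ball_normE /= distrC.
    rewrite -(subrKA x); apply: le_lt_trans (ler_normD _ _) _.
    by rewrite -ltrBrDr.
  have d20 : 0 < d / 2 by rewrite divr_gt0.
  have v1 : 0 < `|v| + 1 by rewrite ltr_wpDl.
  near=> x' h.
  have h0 : h != 0 by near: h; exact: nbhs_dnbhs_neq.
  have x'd : `|x' - x| < d / 2.
    near: x'; apply/nbhs_ballP; exists (d / 2) => // y.
    by rewrite -ball_normE /= distrC.
  have hd : `|h| * `|v| < d / 2.
    apply: (@le_lt_trans _ _ (`|h| * (`|v| + 1))); first by rewrite ler_wpM2l // lerDl.
    rewrite -ltr_pdivlMr //; near: h; apply: nbhs_dnbhs; apply/nbhs_ballP.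
    exists (d / 2 / (`|v| + 1)); first by rewrite /= divr_gt0.
    by move=> s; rewrite -ball_normE /= sub0r normrN.
  have near_x s : 0 <= s <= 1 -> `|x' + s *: (h *: v) - x| < d.
    move=> /andP[s0 s1]; rewrite addrAC (splitr d).
    apply: le_lt_trans (ler_normD _ _) _; apply: ltr_leD => //.
    rewrite !normrZ ger0_norm //; apply: le_trans (ltW hd).
    by rewrite ler_piMl // mulr_ge0.
  have [s s01|c c01 ->] := @MVT_line R _ f x' (h *: v).
    by apply: df; have [+ _] := Hd _ (near_x _ s01).
  have [B1 B2] := Hd _ (near_x _ c01).
  have [_] : `|x' - x0| < rho /\ `|'D_v f x - 'D_v f x'| <= e / 2.
    by apply: Hd; apply: lt_trans x'd _; rewrite ltr_pdivrMr // ltr_pMr // ltr1n.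
  move=> B3.
  have -> : 'D_(h *: v) f (x' + c *: (h *: v)) = h * 'D_v f (x' + c *: (h *: v)).
    by rewrite !deriveE; [exact: linearZ|exact: df|exact: df].
  rewrite mulKf // -(subrKA ('D_v f x)) (splitr e).
  by apply: le_trans (ler_normD _ _) _; apply: lerD; rewrite // distrC.
move=> /(_ cov); apply: filterS => h H x xr; apply: H.
by rewrite /closed_ball_ /= distrC.
Unshelve. all: by end_near. Qed.

End uniform_difference_quotient.

(** A weak form of the Poisson equation with right-hand side [g]: [f] is a uniform
limit of solutions whose right-hand sides converge uniformly to [g].  In contrast
to being C^2, this property is visibly inherited by derivatives. *)
Definition approx_solution {R : realType} {m : nat} (x0 : 'rV[R]_m) (rho : R)
    (f g : 'rV[R]_m -> R) : Prop :=
  forall e : R, 0 < e -> exists w gw : 'rV[R]_m -> R,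
    Ck_on 1 [set x | `|x - x0| < rho] w /\
    forall x, `|x - x0| < rho ->
      [/\ has_laplacian w x (gw x), `|f x - w x| <= e & `|g x - gw x| <= e].

Section regularity.
Context {R : realType} {m : nat}.
Implicit Types (f g w : 'rV[R]_m -> R) (v x : 'rV[R]_m) (rho : R).

Lemma open_norm_ball (x0 : 'rV[R]_m) rho : open [set x | `|x - x0| < rho].
Proof.
rewrite (_ : [set x | _] = ball x0 rho); first exact: ball_open.
by rewrite -ball_normE; apply/seteqP; split=> x /=; rewrite distrC.
Qed.

(** The interior estimate for the difference [w' - w] of two approximants, with [w']
tending to [f], bounds the Lipschitz constant of [f - w]. *)
Lemma approx_solution_Ck1 (x0 : 'rV[R]_m) rho f g : 0 < rho ->
  approx_solution x0 rho f g -> Ck_on 1 [set x | `|x - x0| < rho / 2] f.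
Proof.
move=> r0 H; apply: Ck1_lipschitz_approx => [|e e0]; first exact: open_norm_ball.
have half_lt x : `|x - x0| < rho / 2 -> `|x - x0| < rho.
  by move=> /lt_trans; apply; rewrite ltr_pdivrMr // ltr_pMr // ltr1n.
set L := lipschitz_const m rho; have L0 : 0 <= L by exact: lipschitz_const_ge0.
have L1 : 0 < 2 * L + 1 by rewrite ltr_wpDl // mulr_ge0.
have d0 : 0 < e / (2 * L + 1) by rewrite divr_gt0.
set d := e / (2 * L + 1) in d0; have [w [gw [Cw Hw]]] := H d d0.
exists w; first by apply: Ck_onS Cw => x /=; exact: half_lt.
move=> x y /= xr yr; apply/ler_addgt0Pr => s s0.
have l0 : 0 < 2 + 2 * L * `|y - x| by apply: ltr_wpDr => //; apply: mulr_ge0 => //; exact: mulr_ge0.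
(* With this error for [w'], all terms that involve [w'] add up to [s]. *)
pose d' := s / (2 + 2 * L * `|y - x|).
have d'0 : 0 < d' by rewrite divr_gt0.
have [w' [gw' [Cw' Hw']]] := H d' d'0.
have := @lipschitz_half_ball R m (fun z => w' z - w z) (fun z => gw' z - gw z)
  x0 rho (2 * (d + d')) r0 _ _ _ _ x y xr yr.
have dd : 0 < d + d' by rewrite addr_gt0.
have tri (a b c : R) : `|c - a| <= d -> `|c - b| <= d' -> `|b - a| <= d + d'.
  move=> ca cb; rewrite (_ : b - a = (c - a) - (c - b)); last by ring.
  by apply: le_trans (ler_normB _ _) _; exact: lerD.
have dd2 : d + d' < 2 * (d + d') by rewrite mulr_natl mulr2n ltrDl.
move=> K.
have {}K : `|w' y - w y - (w' x - w x)| <= L * (2 * (d + d')) * `|y - x|.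
  apply: K => z zr; have [h1 h2 h3] := Hw z zr; have [h1' h2' h3'] := Hw' z zr.
  - apply: (@cvgB _ _ _ (nbhs z) _ w' w); [case: Cw'|case: Cw] => + _;
      by move=> /(_ z zr) /differentiable_continuous.
  - exact: has_laplacianB.
  - by apply: le_trans (ltW dd2); exact: tri h2 h2'.
  - by apply: le_lt_trans dd2; exact: tri h3 h3'.
have [_ hx _] := Hw' x (half_lt _ xr); have [_ hy _] := Hw' y (half_lt _ yr).
rewrite (_ : _ - _ = (f y - w' y) - (f x - w' x) + (w' y - w y - (w' x - w x)));
  last by ring.
apply: le_trans (ler_normD _ _) _.
apply: le_trans (lerD (ler_normB _ _) K) _.
apply: le_trans (lerD (lerD hy hx) (lexx _)) _.
rewrite [X in X <= _](_ : _ = 2 * L * d * `|y - x| + d' * (2 + 2 * L * `|y - x|)); last by ring.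
rewrite /d' divfK ?gt_eqF // lerD2r ler_wpM2r //.
by rewrite /d mulrA ler_pdivrMr // (mulrC _ e) ler_pM2l // lerDl.
Qed.

(** The step [h] is chosen first, so that the difference quotients of [f] and [g] are
uniformly close to the derivatives.  The approximant [w] is chosen afterwards, with
an error small compared to [|h|]; its difference quotient then approximates the
derivative of [f]. *)
Lemma approx_solution_derive (x0 : 'rV[R]_m) rho f g v : 0 < rho ->
  approx_solution x0 rho f g -> Ck_on 1 [set x | `|x - x0| < rho] g ->
  approx_solution x0 (rho / 4) (fun x => 'D_v f x) (fun x => 'D_v g x).
Proof.
move=> r0 H Cg e e0; have Cf := approx_solution_Ck1 r0 H.
have r4 : 0 < rho / 4 by rewrite divr_gt0.
have r42 : rho / 4 < rho / 2 by lra.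
have r41 : rho / 4 < rho by lra.
have e2 : 0 < e / 2 by rewrite divr_gt0.
have qf := difference_quotient_unif v r4 r42 e2 Cf.
have qg := difference_quotient_unif v r4 r41 e2 Cg.
have v1 : 0 < `|v| + 1 by rewrite ltr_wpDl.
have nh : \forall h \near (0 : R)^', h != 0 /\ `|h *: v| < rho / 4.
  near=> h; split; first by near: h; exact: nbhs_dnbhs_neq.
  rewrite normrZ; apply: (@le_lt_trans _ _ (`|h| * (`|v| + 1))).
    by rewrite ler_wpM2l // lerDl.
  rewrite -ltr_pdivlMr //; near: h; apply: nbhs_dnbhs; apply/nbhs_ballP.
  exists (rho / 4 / (`|v| + 1)); first by rewrite /= divr_gt0.
  by move=> s; rewrite -ball_normE /= sub0r normrN.
have [h [Hf [Hg [h0 hv]]]] := filter_ex (filterI qf (filterI qg nh)).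
have d0 : 0 < e * `|h| / 4 by rewrite divr_gt0 // mulr_gt0 // normr_gt0.
have [w [gw [Cw Hw]]] := H _ d0.
have in1 x : `|x - x0| < rho / 4 -> `|x - x0| < rho by move=> /lt_trans; exact.
have in2 x : `|x - x0| < rho / 4 -> `|x + h *: v - x0| < rho.
  move=> xr; rewrite addrAC; apply: le_lt_trans (ler_normD _ _) _.
  by apply: lt_trans (ltrD xr hv) _; lra.
exists (fun x => h^-1 * (w (x + h *: v) - w x)).
exists (fun x => h^-1 * (gw (x + h *: v) - gw x)); split.
  have oB : open [set x : 'rV[R]_m | `|x - x0| < rho / 4] by exact: open_norm_ball.
  apply: Ck_onM => //; first exact: Ck_on_cst.
  apply: Ck_onD => //; first by apply: Ck_onS (Ck_on_shift (h *: v) Cw) => x /in2.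
  rewrite (_ : (fun x => - w x) = fun x => -1 * w x).
    apply: Ck_onM => //; first exact: Ck_on_cst.
    by apply: Ck_onS Cw => x /in1.
  by apply/funext => x; rewrite mulN1r.
move=> x xr; have [a1 a2 a3] := Hw _ (in1 _ xr); have [b1 b2 b3] := Hw _ (in2 _ xr).
have close (p q : 'rV[R]_m -> R) : `|p x - q x| <= e * `|h| / 4 ->
    `|p (x + h *: v) - q (x + h *: v)| <= e * `|h| / 4 ->
    `|h^-1 * (p (x + h *: v) - p x) - 'D_v p x| <= e / 2 ->
    `|'D_v p x - h^-1 * (q (x + h *: v) - q x)| <= e.
  move=> p1 p2 p3.
  rewrite (_ : _ - _ = - (h^-1 * (p (x + h *: v) - p x) - 'D_v p x)
    + h^-1 * ((p (x + h *: v) - q (x + h *: v)) - (p x - q x))); last by ring.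
  rewrite (splitr e); apply: le_trans (ler_normD _ _) _.
  apply: lerD; first by rewrite normrN.
  rewrite normrM normfV ler_pdivrMl ?normr_gt0 //.
  apply: le_trans (ler_normB _ _) _; apply: le_trans (lerD p2 p1) _.
  by rewrite le_eqVlt; apply/orP; left; apply/eqP; field.
split.
- by apply: has_laplacianZ; apply: has_laplacianB => //; exact: has_laplacian_shift.
- by apply: close => //; apply: Hf; exact: ltW.
- by apply: close => //; apply: Hg; exact: ltW.
Unshelve. all: by end_near. Qed.

(** Each derivative divides the radius by 4; as C^k is tested at the centre only, this
loss is harmless. *)
Lemma approx_solution_Ck k (x0 : 'rV[R]_m) rho f g : 0 < rho -> approx_solution x0 rho f g ->
  smooth_on [set x | `|x - x0| < rho] g -> Ck_on k [set x0] f.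
Proof.
elim: k rho f g => [|k IH] rho f g r0 H Cg;
  have [df Df] := approx_solution_Ck1 r0 H;
  have x0in : `|x0 - x0| < rho / 2 by rewrite subrr normr0 divr_gt0.
  by move=> x ->; exact/differentiable_continuous/df.
split=> [x ->|v]; first exact: df.
have r4 : 0 < rho / 4 by rewrite divr_gt0.
apply: IH r4 (approx_solution_derive v r0 H (Cg 1%N)) _ => l.
have [_ /(_ v)] := Cg l.+1; apply: Ck_onS => x /= /lt_trans; apply; lra.
Qed.

(** A C^2 solution is its own approximation. *)
Theorem poisson_regularity (U : set 'rV[R]_m) f g : open U -> Ck_on 2 U f ->
  (forall x, U x -> laplacian f x = g x) -> smooth_on U g -> smooth_on U f.
Proof.
move=> oU Cf fg Cg k; apply/Ck_on_pointwise => x0 Ux0.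
have /nbhs_ballP[rho r0 rU] : nbhs x0 U by exact: open_nbhs_nbhs.
have {}rU : [set x | `|x - x0| < rho] `<=` U.
  by move=> x /= xr; apply: rU; rewrite -ball_normE /= distrC.
apply: (@approx_solution_Ck k x0 rho f g) => //; last first.
  by move=> l; exact: Ck_onS rU (Cg l).
move=> e e0; exists f, g; split; first exact: Ck_onS rU (Ck_onW Cf).
move=> x xr; rewrite !subrr normr0 ltW //; split=> //.
by rewrite -fg; [apply: Ck2_has_laplacian oU _ Cf|]; exact: rU.
Qed.

End regularity.

(** * Gradients and Laplacians of products and inverses *)

Section euclidean_ball.
Context {R : realType} {m : nat}.

Lemma sqr_enorm (x : 'rV[R]_m) : enorm x ^+ 2 = dot x x.
Proof. by rewrite /enorm sqr_sqrtr // dot_ge0. Qed.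

Lemma dot_continuous : continuous (fun x : 'rV[R]_m => dot x x).
Proof.
apply: continuous_big => [|j _ x]; first exact: add_continuous.
by apply: (@cvgM _ _ (nbhs x) _ (fun y => y 0 j) (fun y => y 0 j));
  exact: coord_continuous.
Qed.

Lemma open_eball (r : R) : open (eball m r).
Proof.
apply: (@open_comp _ _ (@enorm R m) [set y | y < r]); last exact: open_lt.
move=> x _; apply: (@continuous_comp _ _ _ (fun x : 'rV[R]_m => dot x x) Num.sqrt).
  exact: dot_continuous.
exact: sqrt_continuous.
Qed.

Lemma dotZl (k : R) (x y : 'rV[R]_m) : dot (k *: x) y = k * dot x y.
Proof. by rewrite /dot mulr_sumr; apply: eq_bigr => i _; rewrite mxE mulrA. Qed.

Lemma dotZr (k : R) (x y : 'rV[R]_m) : dot x (k *: y) = k * dot x y.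
Proof. by rewrite /dot mulr_sumr; apply: eq_bigr => i _; rewrite mxE mulrCA. Qed.

End euclidean_ball.

Section laplacian_calculus.
Context {R : realType} {m : nat}.
Variable U : set 'rV[R]_m.
Hypothesis oU : open U.
Implicit Types (f g : 'rV[R]_m -> R) (x : 'rV[R]_m).

Lemma laplacian_eq f g x : (forall y, U y -> f y = g y) -> U x ->
  laplacian f x = laplacian g x.
Proof.
move=> fg Ux; apply: eq_bigr => i _; apply: near_eq_derive.
apply: filterS (open_nbhs_nbhs (conj oU Ux)) => y Uy; apply: near_eq_derive.
by apply: filterS (open_nbhs_nbhs (conj oU Uy)) => z; exact: fg.
Qed.

Lemma laplacian_cst (k : R) x : laplacian (cst k) x = 0.
Proof.
apply: big1 => i _; rewrite /partial.
by under eq_fun do rewrite derive_cst; rewrite derive_cst.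
Qed.

Lemma gradV f x : differentiable f x -> f x != 0 ->
  grad (fun y => (f y)^-1) x = - (f x) ^- 2 *: grad f x.
Proof.
move=> df f0; apply/rowP => i; rewrite !mxE.
by apply: deriveV => //; exact: diff_derivable.
Qed.

Lemma laplacianD f g x : U x -> Ck_on 2 U f -> Ck_on 2 U g ->
  laplacian (fun y => f y + g y) x = laplacian f x + laplacian g x.
Proof.
move=> Ux [df Df] [dg Dg]; rewrite /laplacian -big_split /=; apply: eq_bigr => i _.
have [dDf _] := Df (delta_mx 0 i); have [dDg _] := Dg (delta_mx 0 i).
transitivity ('D_(delta_mx 0 i) (fun y => partial i f y + partial i g y) x).
  apply: near_eq_derive; apply: filterS (open_nbhs_nbhs (conj oU Ux)) => y Uy.
  by apply: deriveD; apply: diff_derivable; [exact: df|exact: dg].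
by apply: deriveD; apply: diff_derivable; [exact: dDf|exact: dDg].
Qed.

Lemma laplacianM f g x : U x -> Ck_on 2 U f -> Ck_on 2 U g ->
  laplacian (fun y => f y * g y) x =
  f x * laplacian g x + 2 * dot (grad f x) (grad g x) + g x * laplacian f x.
Proof.
move=> Ux [df Df] [dg Dg]; rewrite /laplacian /dot !mulr_sumr -!big_split /=.
apply: eq_bigr => i _; rewrite !mxE.
have [dDf _] := Df (delta_mx 0 i); have [dDg _] := Dg (delta_mx 0 i).
have Ef := diff_derivable (df x Ux) : derivable f x (delta_mx 0 i).
have Eg := diff_derivable (dg x Ux) : derivable g x (delta_mx 0 i).
have EDf := diff_derivable (dDf x Ux) : derivable (partial i f) x (delta_mx 0 i).
have EDg := diff_derivable (dDg x Ux) : derivable (partial i g) x (delta_mx 0 i).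
transitivity ('D_(delta_mx 0 i)
    (fun y => f y * partial i g y + g y * partial i f y) x).
  apply: near_eq_derive; apply: filterS (open_nbhs_nbhs (conj oU Ux)) => y Uy.
  by apply: deriveM; apply: diff_derivable; [exact: df|exact: dg].
have Efg : 'D_(delta_mx 0 i) (fun y => f y * partial i g y) x =
    f x * partial i (partial i g) x + partial i g x * partial i f x.
  exact: deriveM Ef EDg.
have Egf : 'D_(delta_mx 0 i) (fun y => g y * partial i f y) x =
    g x * partial i (partial i f) x + partial i f x * partial i g x.
  exact: deriveM Eg EDf.
transitivity ('D_(delta_mx 0 i) (fun y => f y * partial i g y) x +
              'D_(delta_mx 0 i) (fun y => g y * partial i f y) x).
  exact: deriveD (derivableM Ef EDg) (derivableM Eg EDf).
rewrite Efg Egf; move: (partial i (partial i f) x) (partial i (partial i g) x).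
by move: (partial i f x) (partial i g x) (f x) (g x) => *; ring.
Qed.

Lemma laplacianZ (k : R) f x : U x -> Ck_on 2 U f ->
  laplacian (fun y => k * f y) x = k * laplacian f x.
Proof.
move=> Ux Cf; rewrite (laplacianM Ux (Ck_on_cst 2 U k) Cf) laplacian_cst mulr0 addr0.
suff -> : grad (cst k) x = 0 :> 'rV[R]_m.
  by rewrite -(scale0r 0) dotZl mul0r mulr0 addr0.
by apply/rowP => i; rewrite !mxE; exact: derive_cst.
Qed.

End laplacian_calculus.

Lemma derive1_quadratic (R : realType) (A B C t : R) :
  derive1 (fun s => A * s ^+ 2 + B * s + C) t = 2 * A * t + B.
Proof.
pose p : {poly R} := A *: 'X^2 + B *: 'X + C%:P.
have -> : (fun s => A * s ^+ 2 + B * s + C) = horner p.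
  by apply/funext => s; rewrite /p !hornerE.
rewrite -derivE /p !derivD !derivZ derivXn derivX derivC !hornerE /=.
by ring.
Qed.

(** * Quadratic polynomials in time *)

Theorem theorem7p1 (R : realType) (m : nat) (r : R) (hr : 0 < r)
    (a' b c : 'rV[R]_m -> R) :
  let B : set 'rV[R]_m := eball m r in
  let a : 'rV[R]_m -> R := fun x => (a' x)^-1 in
  let u : R -> 'rV[R]_m -> R := fun t x => a x * t ^+ 2 + b x * t + c x in
  harmonic_on B a' ->
  (forall x, B x -> 0 < a' x) ->
  Ck_on 2 B b ->
  (forall x, B x -> laplacian b x = 2 / a x * dot (grad a x) (grad b x)) ->
  Ck_on 2 B c ->
  (forall x, B x ->
     laplacian c x = 1 / (2 * a x) * (enorm (grad b x) ^+ 2 + 1)) ->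
  smooth_on ([set: R] `*` B) (fun p : R * 'rV[R]_m => u p.1 p.2) /\
  (forall (t : R) (x : 'rV[R]_m), B x ->
     derive1n 2 (u^~ x) t * laplacian (u t) x
       - enorm (grad (fun y => derive1 (u^~ y) t) x) ^+ 2 = 1).
Proof.
move=> B a u [Ca' ha'] a'0 Cb hb Cc hc.
have oB : open B by exact: open_eball.
have a'n0 x : B x -> a' x != 0 by move=> /a'0; rewrite lt0r => /andP[].
have an0 x : B x -> a x != 0 by move=> /a'n0; rewrite invr_eq0.
have da' x : B x -> differentiable a' x by case: Ca' => + _; apply.
have db x : B x -> differentiable b x by case: Cb => + _; apply.
have grada x : B x -> grad a x = - (a' x) ^- 2 *: grad a' x.
  by move=> Bx; apply: gradV; [exact: da'|exact: a'n0].
have grada' x : B x -> grad a' x = - (a x) ^- 2 *: grad a x.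
  move=> Bx; rewrite grada // scalerA mulrNN exprVn invrK mulfV ?scale1r //.
  by rewrite expf_neq0 ?a'n0.
have Sa' : smooth_on B a'.
  by apply: (poisson_regularity oB Ca' ha') => k; exact: Ck_on_cst.
have Sa : smooth_on B a by move=> k; exact: (Ck_onV oB a'n0 (Sa' k)).
(* [laplacian b = 2/a grad a . grad b] is equivalent to [a' * b] being harmonic. *)
have Sb : smooth_on B b.
  have Sh : smooth_on B (fun x => a' x * b x).
    apply: (@poisson_regularity _ _ B _ (cst 0) oB (Ck_onM oB Ca' Cb)).
    - move=> x Bx; rewrite (laplacianM oB Bx Ca' Cb) ha' // hb // grada // dotZl.
      by rewrite /a /=; field; exact: a'n0.
    - by move=> k; exact: Ck_on_cst.
  move=> k; apply: (Ck_on_eq oB _ (Ck_onM oB (Sa k) (Sh k))) => x Bx.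
  by rewrite /a mulKf // a'n0.
have Sc : smooth_on B c.
  apply: (@poisson_regularity _ _ B _
    (fun x => 1 / 2 * a' x * (dot (grad b x) (grad b x) + 1)) oB Cc).
    by move=> x Bx; rewrite hc // sqr_enorm /a; field; rewrite a'n0.
  move=> k; apply: (Ck_onM oB (Ck_onM oB (Ck_on_cst k B (1 / 2)) (Sa' k))).
  apply: (Ck_onD oB _ (Ck_on_cst k B 1)); apply: (Ck_on_sum oB) => i.
  under eq_fun do rewrite !mxE.
  have [_ /(_ (delta_mx 0 i)) Db] := Sb k.+1; exact: (Ck_onM oB Db Db).
split=> [k|t x Bx].
  have oRB : open ([set: R] `*` B).
    have -> : [set: R] `*` B = snd @^-1` B by apply/seteqP; split=> p /=; [case|].
    by apply: open_comp => // p _; exact: cvg_snd.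
  have Ct : Ck_on k ([set: R] `*` B) (fun p : R * 'rV[R]_m => p.1).
    exact: Ck_on_fst.
  have Ctt : Ck_on k ([set: R] `*` B) (fun p : R * 'rV[R]_m => p.1 ^+ 2).
    by under eq_fun do rewrite expr2; exact: (Ck_onM oRB Ct Ct).
  have snd := @Ck_on_comp_snd R R 'rV[R]_m k B.
  exact: (Ck_onD oRB (Ck_onD oRB (Ck_onM oRB (snd _ (Sa k)) Ctt)
    (Ck_onM oRB (snd _ (Sb k)) Ct)) (snd _ (Sc k))).
have Ca : Ck_on 2 B a by exact: Sa.
have da : differentiable a x by case: Ca => + _; apply.
have D1 y s : derive1 (u^~ y) s = 2 * a y * s + b y by exact: derive1_quadratic.
have D2 : derive1n 2 (u^~ x) t = 2 * a x.
  rewrite derive1nS derive1n1 (_ : derive1 (u^~ x) = fun s => 0 * s ^+ 2 + 2 * a x * s + b x).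
    by rewrite derive1_quadratic mulr0 mul0r add0r.
  by apply/funext => s; rewrite D1 mul0r add0r.
(* The Laplacian of [a] is read off from [a * a' = 1], which avoids differentiating
   an inverse twice. *)
have La : laplacian a x = 2 / a x * dot (grad a x) (grad a x).
  have := laplacianM oB Bx Ca Ca'.
  rewrite (@laplacian_eq _ _ B oB _ (cst 1)) ?laplacian_cst // => [|y By]; last first.
    by rewrite /a mulVf // a'n0.
  rewrite ha' // grada' // dotZr /a => /esym/eqP.
  rewrite -/a mulr0 add0r addrC addr_eq0 => /eqP E.
  apply: (mulfI (a'n0 _ Bx)); rewrite E /a; field; exact: a'n0.
have Lu : laplacian (u t) x
    = t ^+ 2 * laplacian a x + t * laplacian b x + laplacian c x.
  rewrite /u (_ : (fun _ => _) = fun y => t ^+ 2 * a y + t * b y + c y); last first.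
    by apply/funext => y; rewrite mulrC (mulrC t).
  have Cta : Ck_on 2 B (fun y => t ^+ 2 * a y).
    exact: (Ck_onM oB (Ck_on_cst 2 B (t ^+ 2)) Ca).
  have Ctb : Ck_on 2 B (fun y => t * b y).
    exact: (Ck_onM oB (Ck_on_cst 2 B t) Cb).
  rewrite (laplacianD oB Bx (Ck_onD oB Cta Ctb) Cc) (laplacianD oB Bx Cta Ctb).
  by rewrite (laplacianZ oB _ Bx Ca) (laplacianZ oB _ Bx Cb).
have Gu : grad (fun y => derive1 (u^~ y) t) x = (2 * t) *: grad a x + grad b x.
  rewrite (_ : (fun _ => _) = fun y => (2 * t) * a y + b y); last first.
    by apply/funext => y; rewrite D1; ring.
  apply/rowP => i; rewrite !mxE.
  have dta : derivable (fun y => (2 * t) * a y) x (delta_mx 0 i).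
    by apply: derivableM; [exact: derivable_cst|exact: diff_derivable].
  have dbx : derivable b x (delta_mx 0 i) by exact/diff_derivable/db.
  rewrite [LHS](deriveD dta dbx); congr (_ + _).
  exact: (deriveMl _ (diff_derivable da)).
have dotGu : dot ((2 * t) *: grad a x + grad b x) ((2 * t) *: grad a x + grad b x)
  = 4 * t ^+ 2 * dot (grad a x) (grad a x) + 4 * t * dot (grad a x) (grad b x)
    + dot (grad b x) (grad b x).
  rewrite /dot !mulr_sumr -!big_split /=; apply: eq_bigr => i _.
  by rewrite !mxE; ring.
rewrite D2 Lu Gu La hb // hc // !sqr_enorm dotGu; field; exact: an0.
Qed.
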